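(* Let $G$ and $H$ be groups acting on each other compatibly. If $G$ and $H$ are supersolvable, then the non-abelian tensor product $G\otimes H$ is supersolvable.
   Context: Groups act on themselves by conjugation on the left: ${}^{g}g'=gg'g^{-1}$. Let $G$ act on $H$ and $H$ act on $G$ by automorphisms (left actions, written ${}^{g}h$ and ${}^{h}g$). The mutual actions are compatible if ${}^{({}^{h}g)}h'={}^{hgh^{-1}}h'$ and ${}^{({}^{g}h)}g'={}^{ghg^{-1}}g'$ for all $g,g'\in G$, $h,h'\in H$, where ${}^{hgh^{-1}}h'$ means $h\cdot {}^{g}(h^{-1}h'h)\cdot h^{-1}$ and ${}^{ghg^{-1}}g'$ means $g\cdot {}^{h}(g^{-1}g'g)\cdot g^{-1}$. For compatible actions, the non-abelian tensor product $G\otimes H$ is the group generated by symbols $g\otimes h$ ($g\in G$, $h\in H$) with relations $gg'\otimes h=({}^{g}g'\otimes {}^{g}h)(g\otimes h)$ and $g\otimes hh'=(g\otimes h)({}^{h}g\otimes {}^{h}h')$ for all $g,g'\in G$, $h,h'\in H$. A group is supersolvable if it has a finite series of subgroups, each normal in the whole group, with cyclic successive quotients. *)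

(* Defs.v *)
From HB Require Import structures.
From mathcomp Require Import all_boot ssrint.
From mathcomp Require Import boolp classical_sets.

Set Implicit Arguments.
Unset Strict Implicit.
Unset Printing Implicit Defensive.

Local Open Scope classical_set_scope.
Local Open Scope quotient_scope.
Local Open Scope group_scope.

(* MathComp's x ^ y is the right conjugate y^-1 * x * y; this is the left one. *)
Definition lconj (G : groupType) (g x : G) : G := g * x * g^-1.

Definition expgz (G : groupType) (x : G) (k : int) : G :=
  match k with Posz n => x ^+ n | Negz n => x ^- n.+1 end.

Section Presentation.
Variable X : choiceType.

(* The letter (x, false) stands for x and (x, true) for its inverse. *)
Definition word := seq (X * bool).

Definition inv_letter (l : X * bool) : X * bool := (l.1, ~~ l.2).

Definition inv_word (w : word) : word := rev (map inv_letter w).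

Variable R : word -> word -> Prop.

Inductive word_eq : word -> word -> Prop :=
| word_eq_refl w : word_eq w w
| word_eq_sym w1 w2 : word_eq w1 w2 -> word_eq w2 w1
| word_eq_trans w2 w1 w3 : word_eq w1 w2 -> word_eq w2 w3 -> word_eq w1 w3
| word_eq_cat w1 w1' w2 w2' :
    word_eq w1 w1' -> word_eq w2 w2' -> word_eq (w1 ++ w2) (w1' ++ w2')
| word_eq_cancel l : word_eq [:: l; inv_letter l] [::]
| word_eq_rel w1 w2 : R w1 w2 -> word_eq w1 w2.

Definition word_eqb : rel word := fun w1 w2 => `[< word_eq w1 w2 >].

Lemma word_eqb_refl : reflexive word_eqb.
Proof. by move=> w; apply/asboolP; exact: word_eq_refl. Qed.

Lemma word_eqb_sym : symmetric word_eqb.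
Proof. by move=> w1 w2; apply/asboolP/asboolP; exact: word_eq_sym. Qed.

Lemma word_eqb_trans : transitive word_eqb.
Proof.
move=> w2 w1 w3 /asboolP h12 /asboolP h23; apply/asboolP.
exact: word_eq_trans h12 h23.
Qed.

Canonical word_equiv := EquivRel word_eqb word_eqb_refl word_eqb_sym word_eqb_trans.

(* The group < X | R >. *)
Definition presented_group := {eq_quot word_eqb}.

HB.instance Definition _ := Choice.on presented_group.
HB.instance Definition _ := EqQuotient.on presented_group.

Lemma pi_word_eq (w1 w2 : word) :
  word_eq w1 w2 <-> \pi_presented_group w1 = \pi_presented_group w2.
Proof.
split=> [h|/eqP]; first by apply/eqP; rewrite eqmodE; apply/asboolP.
by rewrite eqmodE => /asboolP.
Qed.

Lemma inv_letterK : involutive inv_letter.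
Proof. by case=> x b; rewrite /inv_letter /= negbK. Qed.

Lemma inv_wordK : involutive inv_word.
Proof.
move=> w; rewrite /inv_word map_rev revK -map_comp.
by rewrite (eq_map (f := _ \o _) (g := id)) ?map_id // => l; exact: inv_letterK.
Qed.

Lemma word_eq_mulV w : word_eq (w ++ inv_word w) [::].
Proof.
elim: w => [|l w IHw]; first exact: word_eq_refl.
have -> : (l :: w) ++ inv_word (l :: w)
    = [:: l] ++ ((w ++ inv_word w) ++ [:: inv_letter l]).
  by rewrite /inv_word /= rev_cons -cats1 catA.
apply: (word_eq_trans _ (word_eq_cancel l)).
apply: (word_eq_cat (w1' := [:: l])); first exact: word_eq_refl.
apply: (word_eq_cat (w1' := [::]) IHw); exact: word_eq_refl.
Qed.

Lemma word_eq_mulVw w : word_eq (inv_word w ++ w) [::].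
Proof. by have := word_eq_mulV (inv_word w); rewrite inv_wordK. Qed.

Lemma word_eq_inv w1 w2 : word_eq w1 w2 -> word_eq (inv_word w1) (inv_word w2).
Proof.
move=> h.
apply: (word_eq_trans (w2 := inv_word w1 ++ (w2 ++ inv_word w2))).
  rewrite -[X in word_eq X _]cats0; apply: word_eq_cat; first exact: word_eq_refl.
  by apply: word_eq_sym; exact: word_eq_mulV.
rewrite catA -[X in word_eq _ X]cat0s; apply: word_eq_cat; last exact: word_eq_refl.
apply: (word_eq_trans _ (word_eq_mulVw w1)).
by apply: word_eq_cat; [exact: word_eq_refl | exact: word_eq_sym].
Qed.

Definition presented_mul (a b : presented_group) : presented_group :=
  \pi_presented_group (repr a ++ repr b).

Definition presented_one : presented_group := \pi_presented_group [::].

Definition presented_inv (a : presented_group) : presented_group :=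
  \pi_presented_group (inv_word (repr a)).

Lemma word_eq_repr w : word_eq (repr (\pi_presented_group w)) w.
Proof. by apply/pi_word_eq; rewrite reprK. Qed.

Lemma presented_mulE w1 w2 :
  presented_mul (\pi w1) (\pi w2) = \pi_presented_group (w1 ++ w2).
Proof. by apply/pi_word_eq; apply: word_eq_cat; exact: word_eq_repr. Qed.

Lemma presented_invE w : presented_inv (\pi w) = \pi_presented_group (inv_word w).
Proof. by apply/pi_word_eq; apply: word_eq_inv; exact: word_eq_repr. Qed.

Lemma presented_mulA : associative presented_mul.
Proof.
by move=> a b c; rewrite -[a]reprK -[b]reprK -[c]reprK !presented_mulE catA.
Qed.

Lemma presented_mul1 : left_id presented_one presented_mul.
Proof. by move=> a; rewrite -[a]reprK presented_mulE. Qed.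

Lemma presented_mulg1 : right_id presented_one presented_mul.
Proof. by move=> a; rewrite -[a]reprK presented_mulE cats0. Qed.

Lemma presented_mulV : left_inverse presented_one presented_inv presented_mul.
Proof.
move=> a; rewrite -[a]reprK presented_invE presented_mulE.
by apply/pi_word_eq; exact: word_eq_mulVw.
Qed.

Lemma presented_mulgV : right_inverse presented_one presented_inv presented_mul.
Proof.
move=> a; rewrite -[a]reprK presented_invE presented_mulE.
by apply/pi_word_eq; exact: word_eq_mulV.
Qed.

HB.instance Definition _ := isGroup.Build presented_group
  presented_mulA presented_mul1 presented_mulg1 presented_mulV presented_mulgV.

End Presentation.

Section Actions.
Variables G H : groupType.

Definition acts_by_automorphisms (act : G -> H -> H) : Prop :=
  [/\ forall h, act 1 h = h,
      forall g g' h, act (g * g') h = act g (act g' h)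
    & forall g, {morph act g : h h' / h * h'}].

Variables (aGH : G -> H -> H) (aHG : H -> G -> G).

Definition compatible_actions : Prop :=
  (forall g h h', aGH (aHG h g) h' = h * aGH g (h^-1 * h' * h) * h^-1) /\
  (forall g g' h, aHG (aGH g h) g' = g * aHG h (g^-1 * g' * g) * g^-1).

Definition tensor_letter (g : G) (h : H) : (G * H) * bool := ((g, h), false).

Inductive tensor_rel : word (G * H)%type -> word (G * H)%type -> Prop :=
| tensor_rel_mull g g' h :
    tensor_rel [:: tensor_letter (g * g') h]
      [:: tensor_letter (lconj g g') (aGH g h); tensor_letter g h]
| tensor_rel_mulr g h h' :
    tensor_rel [:: tensor_letter g (h * h')]
      [:: tensor_letter g h; tensor_letter (aHG h g) (lconj h h')].

Definition nonabelian_tensor : groupType := presented_group tensor_rel.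

End Actions.

Section Supersolvable.
Variable G : groupType.

Definition normal_subgroup (N : set G) : Prop :=
  group_closed (mem N) /\ forall g x, N x -> N (lconj g x).

Definition left_coset (N : set G) (x : G) : set G := [set x * y | y in N].

(* B / A is cyclic: some coset bA generates it, where (bA)^k = (b^k)A. *)
Definition cyclic_quotient (A B : set G) : Prop :=
  exists2 b, B b & forall x, B x ->
    exists k : int, left_coset A x = left_coset A (expgz b k).

Definition supersolvable : Prop :=
  exists (n : nat) (S : nat -> set G),
    [/\ S 0 = [set 1], S n = [set: G],
        forall i, i <= n -> normal_subgroup (S i)
      & forall i, i < n -> S i `<=` S i.+1 /\ cyclic_quotient (S i) (S i.+1)].

End Supersolvable.

(* Main.v *)
Require Import Defs.
From HB Require Import structures.
From mathcomp Require Import all_boot ssralg ssrint intdiv.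
From mathcomp Require Import boolp classical_sets.

Set Implicit Arguments.
Unset Strict Implicit.
Unset Printing Implicit Defensive.

Local Open Scope classical_set_scope.
Local Open Scope quotient_scope.
Local Open Scope group_scope.

(** The tensor product T of G and H carries two homomorphisms,
    toG : g (x) h |-> g . h(g)^-1 and toH : g (x) h |-> g(h) . h^-1, and actions
    of G and H which extend the given actions and conjugation. Both
    homomorphisms are crossed modules: t conjugates T as toG t and as toH t do
    (actG_toG, actH_toH). Moreover g (x) toH t = g(t) t^-1 and
    toG t (x) h = t h(t)^-1 (tensor_toH, tensor_toG). Hence G fixes ker toH,
    H fixes ker toG, and the common kernel J is central in T and fixed
    pointwise by both actions.

    Pulling back the series of G along toG, and then that of H along toH inside
    ker toG, gives a series of normal subgroups of T with cyclic quotients going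
    from J to T. It remains to continue it from J down to 1; since J is
    central, it suffices that J is finitely generated, and this takes two
    steps.

    First, T is finitely generated (tensor_finitely_generated). Let ts be
    finitely many elements that generate T modulo J. Each of the elements k(t),
    with t in ts and k a generator of G or H or its inverse, and each u (x) v,
    with u and v generators, is a word in ts times an element of J. Add these
    finitely many elements of J to ts. The resulting subgroup is stable under
    G and H, because they fix J, and contains the u (x) v, so by the defining
    relations it contains all g (x) h.

    Secondly, if E is a finitely generated group and A is the bottom of a
    normal series with cyclic quotients which ends at E, then A is the normal
    closure of a finite set (cyclic_series_normal_closure): the property
    descends along the series, from B to A when B / A is cyclic. This is the
    part of the finite presentability of supersolvable groups that matters
    here. For A = J central, the normal closure of a finite set has an evident
    series (central_cyclic_series). *)

Ltac gsimp := rewrite /lconj ?(invgM, invgK, invg1) -?mulgA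
  ?(mulKg, mulVKg, mulVg, mulgV, mul1g, mulg1).

(** * Integer powers *)

Section IntegerPowers.
Import GRing.Theory.

Lemma expgzS (G : groupType) (x : G) (k : int) :
  expgz x (k + 1)%R = expgz x k * x.
Proof.
case: k => n; first by rewrite -PoszD addn1 /= expgSr.
rewrite NegzE -addn1 PoszD opprD addrNK.
case: n => [|n]; first by rewrite oppr0 /= mulVg.
by rewrite -NegzE /= addn0 (expgS x n.+1) invgM mulgVK.
Qed.

Lemma expgzD (G : groupType) (x : G) (k l : int) :
  expgz x (k + l)%R = expgz x k * expgz x l.
Proof.
elim: l => [|n IHn|n IHn]; first by rewrite addr0 mulg1.
  by rewrite -addn1 PoszD addrA !expgzS IHn mulgA.
apply: (@mulIg _ x); rewrite -mulgA -!expgzS.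
by rewrite -addn1 PoszD opprD addrNK addrA addrNK IHn.
Qed.

Lemma expgzN (G : groupType) (x : G) (k : int) :
  expgz x (- k)%R = (expgz x k)^-1.
Proof. by apply: (@mulIg _ (expgz x k)); rewrite mulVg -expgzD addNr. Qed.

Lemma expgzM (G : groupType) (x : G) (k l : int) :
  expgz x (l * k)%R = expgz (expgz x k) l.
Proof.
elim: l => [|n IHn|n IHn]; first by rewrite mul0r.
  by rewrite -addn1 PoszD mulrDl mul1r !expgzD IHn.
apply: (@mulIg _ (expgz x k)); rewrite -expgzS -expgzD -{2}(mul1r k) -mulrDl.
by rewrite -addn1 PoszD opprD addrNK IHn.
Qed.

Lemma int_subgroup_principal (P : int -> Prop) :
  P 0%R -> (forall k l, P k -> P l -> P (k - l)%R) ->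
  exists2 d, P d & forall k, P k -> exists q, k = (q * d)%R.
Proof.
move=> P0 PB.
have PN k : P k -> P (- k)%R by move=> Pk; rewrite -(sub0r k); exact: PB.
have PD k l : P k -> P l -> P (k + l)%R.
  by move=> Pk Pl; rewrite -(opprK l); apply/PB/PN.
have PM d q : P d -> P (q * d)%R.
  move=> Pd; elim: q => [|n IHn|n IHn]; first by rewrite mul0r.
    by rewrite -addn1 PoszD mulrDl mul1r; exact: PD.
  by rewrite -addn1 PoszD opprD mulrDl mulN1r; exact: PB.
have [[n n_gt0 Pn]|noP] := pselect (exists2 n : nat, (0 < n)%N & P n);
  last first.
  exists 0%R => // k Pk; exists 0%R; rewrite mulr0.
  have [//|k_neq0] := eqVneq k 0%R.
  case: noP; exists `|k|%N; first by rewrite absz_gt0.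
  by case: (intP k) k_neq0 Pk => // m _ /PN; rewrite opprK.
have exP : exists n : nat, (0 < n)%N && `[< P n >].
  by exists n; rewrite n_gt0; apply/asboolP.
case: (ex_minnP exP) => d /andP[d_gt0 /asboolP Pd] dmin.
exists d => // k Pk; exists (k %/ d)%Z; rewrite {1}(divz_eq k d).
suff -> : (k %% d)%Z = 0%R by rewrite addr0.
have d_neq0 : (d : int) != 0%R by rewrite eqz_nat -lt0n.
have Pr : P (k %% d)%Z by rewrite /modz; apply: PB => //; exact: PM.
have := modz_ge0 k d_neq0; have := ltz_pmod k (d := (d : int)) d_gt0.
case: (k %% d)%Z Pr => // r Pr r_lt _.
have [->//|r_gt0] := posnP r.
have := dmin r; rewrite r_gt0 => /(_ (asboolT Pr)).
by rewrite leqNgt -ltz_nat r_lt.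
Qed.

End IntegerPowers.

(** * Subgroups, homomorphisms and cosets *)

Section Subgroups.
Variable G : groupType.
Implicit Types (P A B N : set G) (x y : G).

Definition is_subgroup P : Prop :=
  [/\ P 1, forall x y, P x -> P y -> P (x * y) & forall x, P x -> P x^-1].

Lemma normal_subgroupE N :
  normal_subgroup N <-> is_subgroup N /\ forall g x, N x -> N (lconj g x).
Proof.
split=> -[Ng Nc]; split=> //.
  have mE x : (x \in mem N) = (x \in N) by [].
  split; first by have := Ng.1; rewrite mE inE.
    move=> x y Nx Ny; have := @group_closedM _ _ Ng x y.
    by rewrite !mE !inE; exact.
  move=> x Nx; have := @group_closedV _ _ Ng x.
  by rewrite !mE !inE; exact.
have mE x : (x \in mem N) = (x \in N) by [].
case: Ng => N1 NM NV; split; first by rewrite mE inE.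
by move=> x y; rewrite !mE !inE => Nx Ny; apply/NM/NV.
Qed.

Lemma normal_is_subgroup N : normal_subgroup N -> is_subgroup N.
Proof. by case/normal_subgroupE. Qed.

Lemma subgroup_expgz P x k : is_subgroup P -> P x -> P (expgz x k).
Proof.
move=> [P1 PM PV] Px.
have PX n : P (x ^+ n) by elim: n => [//|n IHn]; rewrite expgS; exact: PM.
by case: k => n /=; last apply: PV; exact: PX.
Qed.

Lemma subgroupI P Q : is_subgroup P -> is_subgroup Q -> is_subgroup (P `&` Q).
Proof.
move=> [P1 PM PV] [Q1 QM QV]; split; first by [].
  by move=> x y [Px Qx] [Py Qy]; split; [exact: PM | exact: QM].
by move=> x [Px Qx]; split; [exact: PV | exact: QV].
Qed.

Lemma normal_subgroupI A B :
  normal_subgroup A -> normal_subgroup B -> normal_subgroup (A `&` B).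
Proof.
move=> /normal_subgroupE[sA nA] /normal_subgroupE[sB nB].
apply/normal_subgroupE; split; first exact: subgroupI.
by move=> g x [Ax Bx]; split; [exact: nA | exact: nB].
Qed.

Lemma normal_subgroupT : normal_subgroup [set: G].
Proof. by apply/normal_subgroupE. Qed.

Lemma normal_subgroup1 : normal_subgroup [set 1 : G].
Proof.
apply/normal_subgroupE; split.
  by split=> //= [x y -> ->|x ->]; rewrite ?mulg1 ?invg1.
by move=> g x /= ->; rewrite /lconj mulg1 mulgV.
Qed.

Lemma left_cosetE A x y : is_subgroup A ->
  left_coset A x = left_coset A y <-> A (y^-1 * x).
Proof.
move=> [A1 AM AV]; split=> [eqA|Ayx].
  have : left_coset A x x by exists 1 => //; rewrite mulg1.
  by rewrite eqA => -[z Az <-]; rewrite mulKg.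
apply/seteqP; split=> z [a Aa <-].
  by exists (y^-1 * x * a); [exact: AM | rewrite -mulgA mulVKg].
exists ((y^-1 * x)^-1 * a); first by apply: AM => //; exact: AV.
by gsimp.
Qed.

Lemma cyclic_quotientE A B : is_subgroup A ->
  cyclic_quotient A B <->
  exists2 b, B b & forall x, B x -> exists k, A ((expgz b k)^-1 * x).
Proof.
move=> sA; split=> -[b Bb bgen]; exists b => // x /bgen[k xk]; exists k.
  exact/left_cosetE.
exact/left_cosetE.
Qed.

Section Congruence.
Variable A : set G.
Hypothesis nA : normal_subgroup A.

Lemma congM x y u v :
  A (x^-1 * y) -> A (u^-1 * v) -> A ((x * u)^-1 * (y * v)).
Proof.
case/normal_subgroupE: nA => -[_ AM _] AJ Axy Auv.
have := AM _ _ (AJ u^-1 _ Axy) Auv.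
by gsimp.
Qed.

Lemma congV x y : A (x^-1 * y) -> A (x^-1^-1 * y^-1).
Proof.
case/normal_subgroupE: nA => -[_ _ AV] AJ Axy.
by have := AJ x _ (AV _ Axy); gsimp.
Qed.

Lemma congXz x y k : A (x^-1 * y) -> A ((expgz x k)^-1 * expgz y k).
Proof.
move=> Axy; have congX n : A ((x ^+ n)^-1 * y ^+ n).
  elim: n => [|n IHn]; last by rewrite !expgS; exact: congM.
  by rewrite !expg0 mulVg; case/normal_subgroupE: nA => -[].
by case: k => n /=; [exact: congX | exact: congV].
Qed.

End Congruence.

End Subgroups.

Section LeftConjugation.
Variable G : groupType.
Implicit Types x y g : G.

Lemma lconj1 x : lconj 1 x = x.
Proof. by gsimp. Qed.

Lemma lconjA g h x : lconj (g * h) x = lconj g (lconj h x).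
Proof. by gsimp. Qed.

Lemma lconjM g : {morph lconj g : x y / x * y}.
Proof. by move=> x y; gsimp. Qed.

Lemma lconjK x : cancel (lconj x) (lconj x^-1).
Proof. by move=> y; gsimp. Qed.

Lemma lconjVK x : cancel (lconj x^-1) (lconj x).
Proof. by move=> y; gsimp. Qed.

Lemma lconj_mul x y : lconj x y * x = x * y.
Proof. by gsimp. Qed.

End LeftConjugation.

Section Homomorphisms.
Variables (E Q : groupType) (f : E -> Q).
Hypothesis fM : {morph f : x y / x * y}.

Lemma hom1 : f 1 = 1.
Proof. by apply: (@mulgI _ (f 1)); rewrite -fM !mulg1. Qed.

Lemma homV x : f x^-1 = (f x)^-1.
Proof. by apply: (@mulgI _ (f x)); rewrite -fM !mulgV hom1. Qed.

Lemma homJ x y : f (lconj x y) = lconj (f x) (f y).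
Proof. by rewrite /lconj !fM homV. Qed.

Lemma homXz x k : f (expgz x k) = expgz (f x) k.
Proof.
have fX n : f (x ^+ n) = f x ^+ n.
  by elim: n => [|n IHn]; rewrite ?hom1 // !expgS fM IHn.
by case: k => n /=; rewrite ?homV fX.
Qed.

Lemma preim_subgroup A : is_subgroup A -> is_subgroup (f @^-1` A).
Proof.
move=> [A1 AM AV]; split; rewrite /preimage /=; first by rewrite hom1.
  by move=> x y Ax Ay; rewrite fM; exact: AM.
by move=> x Ax; rewrite homV; exact: AV.
Qed.

Lemma preim_normal A : normal_subgroup A -> normal_subgroup (f @^-1` A).
Proof.
move=> /normal_subgroupE[sA AJ]; apply/normal_subgroupE.
split; first exact: preim_subgroup.
by move=> g x; rewrite /preimage /= homJ; exact: AJ.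
Qed.

(** A subgroup of a cyclic group is cyclic: the exponents k for which the coset
    of b ^ k meets the image form a subgroup of the integers, and a preimage
    for the generator of that subgroup does the job. Intersecting with M lets
    the same lemma refine a series inside the kernel of another
    homomorphism. *)
Lemma cyclic_quotient_preim (M : set E) (A B : set Q) :
    is_subgroup M -> normal_subgroup A -> is_subgroup B ->
    cyclic_quotient A B ->
  cyclic_quotient (M `&` f @^-1` A) (M `&` f @^-1` B).
Proof.
move=> sM nA sB; have sA := normal_is_subgroup nA.
move=> /(cyclic_quotientE _ sA)[b Bb bgen].
apply/cyclic_quotientE; first exact: subgroupI (preim_subgroup sA).
pose I k := exists2 x, (M `&` f @^-1` B) x & A ((expgz b k)^-1 * f x).
have sMB : is_subgroup (M `&` f @^-1` B) by apply/subgroupI/preim_subgroup.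
have [] := @int_subgroup_principal I.
- exists 1; first by case: sMB.
  by rewrite hom1 mulg1 invg1; case: sA.
- move=> k l [x Mx Ax] [y My Ay]; exists (x * y^-1).
    by case: sMB => _ MM MV; apply/MM/MV.
  rewrite fM homV expgzD expgzN; apply: congM => //; exact: congV.
move=> d [y MBy Ay] dgen; exists y => // x MBx.
have [k Ak] := bgen _ MBx.2; have [|q kE] := dgen k; first by exists x.
exists q; split.
  case: (sMB) => _ MM MV; apply: (MM _ _ _ _).1 => //.
  by apply: MV; exact: subgroup_expgz.
rewrite /preimage /= fM homV homXz.
have := congXz nA q Ay; rewrite -expgzM -kE => Ay'.
have [_ AM AV] := sA; have := AM _ _ (AV _ Ay') Ak.
by gsimp.
Qed.

End Homomorphisms.

Lemma hom_comp (E Q K : groupType) (f : Q -> K) (f' : E -> Q) :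
  {morph f : x y / x * y} -> {morph f' : x y / x * y} ->
  {morph f \o f' : x y / x * y}.
Proof. by move=> fM f'M x y /=; rewrite f'M fM. Qed.

(** * Normal series with cyclic quotients *)

(** Unlike the indexed families in the definition of supersolvability, these
    series start at an arbitrary normal subgroup and can be concatenated. *)
Inductive cyclic_series (G : groupType) (A : set G) : set G -> Prop :=
| cyclic_series_refl : normal_subgroup A -> cyclic_series A A
| cyclic_series_step B C : cyclic_series A B -> normal_subgroup C ->
    B `<=` C -> cyclic_quotient B C -> cyclic_series A C.

Section Series.
Variable G : groupType.
Implicit Types (A B C : set G).

Lemma cyclic_series_normal A B :
  cyclic_series A B -> normal_subgroup A /\ normal_subgroup B.
Proof. by elim=> // {}B C _ [nA nB] nC _ _. Qed.

Lemma cyclic_series_trans A B C :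
  cyclic_series A B -> cyclic_series B C -> cyclic_series A C.
Proof.
move=> serAB; elim=> // {}C D _ IH nD sCD cycCD.
exact: cyclic_series_step IH nD sCD cycCD.
Qed.

Lemma supersolvableP :
  supersolvable G <-> cyclic_series [set 1] [set: G].
Proof.
split=> [[n [S [S0 Sn Sn_normal Sstep]]]|].
  rewrite -Sn -S0; have: n <= n by [].
  elim: {-2}n => [_|i IHi lt_in]; first exact/cyclic_series_refl/Sn_normal.
  have [sS cS] := Sstep i lt_in.
  exact: cyclic_series_step (IHi (ltnW lt_in)) (Sn_normal _ lt_in) sS cS.
suff gen A B : cyclic_series A B -> exists (n : nat) (S : nat -> set G),
    [/\ S 0 = A, S n = B, forall i, i <= n -> normal_subgroup (S i)
      & forall i, i < n -> S i `<=` S i.+1 /\ cyclic_quotient (S i) (S i.+1)].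
  exact: gen.
elim=> [nA|{}B C _ [n [S [S0 Sn Snormal Sstep]]] nC sBC cycBC].
  by exists 0, (fun=> A); split.
exists n.+1, (fun i => if i <= n then S i else C).
split=> [//||i|i]; rewrite ?ltnn //.
  by case: ifP => // le_in _; exact: Snormal.
rewrite ltnS => le_in; rewrite le_in; case: ifP => [/Sstep//|].
move=> /negbT; rewrite -leqNgt => le_ni.
by have -> : i = n; [apply/eqP; rewrite eqn_leq le_in | rewrite Sn].
Qed.

End Series.

Lemma cyclic_series_preim (E Q : groupType) (f : E -> Q) (M : set E) A B :
    {morph f : x y / x * y} -> normal_subgroup M -> cyclic_series A B ->
  cyclic_series (M `&` f @^-1` A) (M `&` f @^-1` B).
Proof.
move=> fM nM.
elim=> [nA|{}B C serAB IH nC sBC cycBC].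
  exact/cyclic_series_refl/normal_subgroupI/preim_normal.
have [_ nB] := cyclic_series_normal serAB.
apply: cyclic_series_step IH _ _ _.
- exact/normal_subgroupI/preim_normal.
- by move=> x [Mx Bx]; split=> //; exact: sBC.
- by apply: cyclic_quotient_preim => //; exact: normal_is_subgroup.
Qed.

(** * Finite generation *)

Definition generated (G : groupType) (S : set G) := smallest (@is_subgroup G) S.

Definition normal_closure (G : groupType) (S : set G) :=
  smallest (@normal_subgroup G) S.

Definition finitely_generated (G : groupType) : Prop :=
  exists s : seq G, [set: G] `<=` generated [set` s].

Section Generation.
Variable G : groupType.
Implicit Types (A B C S : set G) (s e : seq G).

Lemma generated_subgroup S : is_subgroup (generated S).
Proof.
split=> [P [[]]//|x y Sx Sy P sP|x Sx P sP].
  by case: (sP) => -[_ PM _] _; apply: PM; [exact: Sx | exact: Sy].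
by case: (sP) => -[_ _ PV] _; apply: PV; exact: Sx.
Qed.

Lemma normal_closure_normal S : normal_subgroup (normal_closure S).
Proof.
apply/normal_subgroupE; split; first split.
- by move=> P [/normal_subgroupE[[]]].
- move=> x y Sx Sy P sP; case: (sP) => /normal_subgroupE[[_ PM _] _] _.
  by apply: PM; [exact: Sx | exact: Sy].
- move=> x Sx P sP; case: (sP) => /normal_subgroupE[[_ _ PV] _] _.
  by apply: PV; exact: Sx.
move=> g x Sx P sP; case: (sP) => /normal_subgroupE[_ PJ] _.
by apply: PJ; exact: Sx.
Qed.

Lemma cyclic_series_generated A C : cyclic_series A C ->
  exists s, C `<=` generated (A `|` [set` s]).
Proof.
elim=> [nA|{}B {}C serAB [s Bs] nC sBC cycBC].
  by exists [::] => x Ax; apply: sub_gen_smallest; left.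
have [_ /normal_is_subgroup sB] := cyclic_series_normal serAB.
case/(cyclic_quotientE _ sB): cycBC => b Cb bgen.
exists (b :: s) => x Cx; have [k Bk] := bgen _ Cx.
have sG := generated_subgroup (A `|` [set` b :: s]).
rewrite -(mulVKg (expgz b k) x); case: (sG) => _ GM _; apply: GM.
  apply: (subgroup_expgz _ sG); apply: sub_gen_smallest; right.
  by rewrite /= mem_head.
apply: (smallest_sub sG) (Bs _ Bk) => y [Ay|sy]; apply: sub_gen_smallest.
  by left.
by right; rewrite /= inE sy orbT.
Qed.

Lemma supersolvable_finitely_generated :
  supersolvable G -> finitely_generated G.
Proof.
move=> /supersolvableP/cyclic_series_generated[s Gs]; exists s => x /Gs.
apply: (smallest_sub (generated_subgroup _)) => y [->|sy];
  last exact: sub_gen_smallest.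
by case: (generated_subgroup [set` s]).
Qed.

(** The product <b> A. *)
Definition cyclic_extension A (b : G) : set G :=
  [set x | exists k, A ((expgz b k)^-1 * x)].

Lemma sub_cyclic_extension A b : A `<=` cyclic_extension A b.
Proof. by move=> x Ax; exists 0%R; rewrite /= invg1 mul1g. Qed.

Lemma mem_cyclic_extension A b : is_subgroup A -> cyclic_extension A b b.
Proof. by move=> [A1 _ _]; exists 1%R; rewrite /= mulVg. Qed.

Lemma cyclic_extension_subgroup A b :
  normal_subgroup A -> is_subgroup (cyclic_extension A b).
Proof.
move=> nA; have [A1 _ _] := normal_is_subgroup nA; split.
- exact: sub_cyclic_extension.
- by move=> x y [k Ak] [l Al]; exists (k + l)%R; rewrite expgzD; exact: congM.
- by move=> x [k Ak]; exists (- k)%R; rewrite expgzN; exact: congV.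
Qed.

(** Conjugation by g is a homomorphism, so stability need only be tested
    at b. *)
Lemma cyclic_extension_lconj A b g x : normal_subgroup A ->
  cyclic_extension A b (lconj g b) -> cyclic_extension A b x ->
  cyclic_extension A b (lconj g x).
Proof.
move=> nA Wgb [k Ax]; have sW := cyclic_extension_subgroup b nA.
rewrite -(mulVKg (expgz b k) x) lconjM (homXz (lconjM g)).
have [_ WM _] := sW; apply: WM; first exact: subgroup_expgz sW Wgb.
by apply: sub_cyclic_extension; case/normal_subgroupE: nA => _; exact.
Qed.

(** Let b generate B modulo A. Every x in B is b ^ k * r x with r x in A. Take
    for generators of A the remainders r x, where x runs through the given
    generators of B and the conjugates of b by the generators of the group and
    their inverses, together with b ^ m, where m generates the set of k such
    that b ^ k lies in A. Their normal closure A0 satisfies B = <b> A0, since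
    <b> A0 is normal and contains the generators of B. An element b ^ k * a of
    A with a in A0 has k divisible by m, so it lies in A0. *)
Lemma normal_closure_cyclic_quotient A B s : finitely_generated G ->
    normal_subgroup A -> A `<=` B -> cyclic_quotient A B ->
    B = normal_closure [set` s] ->
  exists s', A = normal_closure [set` s'].
Proof.
move=> [e Ge] nA sAB cycAB defB; have sA := normal_is_subgroup nA.
case/(cyclic_quotientE _ sA): cycAB => b Bb bgen.
have [x|r rP] := @choice G G (fun x a =>
    A a /\ (B x -> exists k, (expgz b k)^-1 * x = a)).
  have [Bx|nBx] := pselect (B x); last by exists 1; split=> //; case: sA.
  have [k Ak] := bgen _ Bx.
  by exists ((expgz b k)^-1 * x); split=> // _; exists k.
have [|k l Ak Al|m Am mgen] :=
  @int_subgroup_principal (fun k => A (expgz b k)).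
- by case: sA.
- by rewrite expgzD expgzN; case: sA => _ AM AV; apply/AM/AV.
have nB : normal_subgroup B by rewrite defB; exact: normal_closure_normal.
have BJ g : B (lconj g b) by case/normal_subgroupE: nB => _; exact.
pose bs := s ++ [seq lconj g b | g <- e] ++ [seq lconj g^-1 b | g <- e].
have sbsB x : x \in bs -> B x.
  rewrite !mem_cat => /orP[sx|/orP[|]/mapP[g _ ->]//].
  by rewrite defB; apply: sub_gen_smallest.
pose s' := expgz b m :: map r bs; exists s'.
set A0 := normal_closure _.
have nA0 : normal_subgroup A0 by exact: normal_closure_normal.
have sA0A : A0 `<=` A.
  apply: smallest_sub => // x /=; rewrite inE => /predU1P[->//|/mapP[y _ ->]].
  by case: (rP y).
have s'A0 x : x \in s' -> A0 x by move=> s'x; apply: sub_gen_smallest.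
have sA0 := normal_is_subgroup nA0; have [_ A0M _] := sA0.
pose W := cyclic_extension A0 b.
have sW : is_subgroup W by exact: cyclic_extension_subgroup.
have sbsW x : x \in bs -> W x.
  move=> bsx; have [k kx] := (rP x).2 (sbsB x bsx).
  by exists k; rewrite kx; apply: s'A0; rewrite inE map_f ?orbT.
have nW : normal_subgroup W.
  apply/normal_subgroupE; split=> // g y.
  apply: cyclic_extension_lconj => // {y}.
  suff: [set g | W (lconj g b) /\ W (lconj g^-1 b)] g by case.
  apply: smallest_sub (Ge g _) => //.
    split=> [|x y [Wx Wx'] [Wy Wy']|x [Wx Wx']] /=.
    - by rewrite invg1 lconj1; split; exact: mem_cyclic_extension.
    - by rewrite invgM !lconjA; split; apply: cyclic_extension_lconj.
    - by rewrite invgK.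
  move=> x /= ex; split; apply: sbsW; rewrite !mem_cat.
    by rewrite (map_f (fun g => lconj g b) ex) orbT.
  by rewrite (map_f (fun g => lconj g^-1 b) ex) !orbT.
have sBW : B `<=` W.
  rewrite defB; apply: smallest_sub => // x /= sx.
  by apply: sbsW; rewrite mem_cat sx.
apply/seteqP; split=> // x Ax; have [k A0x] := sBW x (sAB x Ax).
have [q kE] : exists q, k = (q * m)%R.
  apply: mgen; have [_ AM AV] := sA.
  by have := AM _ _ Ax (AV _ (sA0A _ A0x)); gsimp.
rewrite -(mulVKg (expgz b k) x); apply: A0M => //.
rewrite kE expgzM; apply: (subgroup_expgz q sA0).
by apply: s'A0; rewrite mem_head.
Qed.

Lemma cyclic_series_normal_closure A : finitely_generated G ->
  cyclic_series A [set: G] -> exists s, A = normal_closure [set` s].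
Proof.
move=> fgG serA; have [e Ge] := fgG.
have: exists s, [set: G] = normal_closure [set` s].
  exists e; apply/seteqP; split=> // x /Ge; apply: smallest_sub.
    exact/normal_is_subgroup/normal_closure_normal.
  exact: sub_gen_smallest.
elim: serA => // B C serAB IH nC sBC cycBC [s defC]; apply: IH.
have [_ nB] := cyclic_series_normal serAB.
exact: normal_closure_cyclic_quotient cycBC defC.
Qed.

(** By centrality, adjoining one more generator to the normal closure of the
    others produces a cyclic quotient. *)
Lemma central_cyclic_series s : (forall x g, x \in s -> lconj g x = x) ->
  cyclic_series [set 1] (normal_closure [set` s]).
Proof.
elim: s => [_|b s IHs cs].
  have -> : normal_closure [set` [::]] = [set 1 : G].
    apply/seteqP; split; first by apply: (smallest_sub (@normal_subgroup1 G)).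
    move=> x ->.
    by have [] := normal_is_subgroup (normal_closure_normal [set` [::]]).
  exact/cyclic_series_refl/normal_subgroup1.
set B := normal_closure [set` s] in IHs *; set C := normal_closure _.
have nB : normal_subgroup B by exact: normal_closure_normal.
have nC : normal_subgroup C by exact: normal_closure_normal.
apply: (cyclic_series_step (B := B)) => //.
- by apply: IHs => x g sx; apply: cs; rewrite inE sx orbT.
- apply: smallest_sub => // x /= sx; apply: sub_gen_smallest.
  by rewrite /= inE sx orbT.
have sB := normal_is_subgroup nB.
apply/(cyclic_quotientE _ sB); exists b.
  by apply: sub_gen_smallest; rewrite /= mem_head.
suff sCW : C `<=` cyclic_extension B b by [].
apply: smallest_sub; last first.
  move=> x /=; rewrite inE => /predU1P[->|sx].
    exact: mem_cyclic_extension.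
  by apply: sub_cyclic_extension; apply: sub_gen_smallest.
apply/normal_subgroupE; split; first exact: cyclic_extension_subgroup.
move=> g x; apply: cyclic_extension_lconj => //.
by rewrite cs ?mem_head //; exact: mem_cyclic_extension.
Qed.

Lemma central_supersolvable J : finitely_generated G ->
    cyclic_series J [set: G] -> (forall x g, J x -> lconj g x = x) ->
  supersolvable G.
Proof.
move=> fgG serJ cJ; apply/supersolvableP; apply: (cyclic_series_trans _ serJ).
have [s defJ] := cyclic_series_normal_closure fgG serJ.
rewrite defJ; apply: central_cyclic_series => x g sx.
by apply: cJ; rewrite defJ; exact: sub_gen_smallest.
Qed.

Lemma generated_mono S S' : S `<=` S' -> generated S `<=` generated S'.
Proof.
by move=> sSS'; apply: sub_smallest2r sSS'; exact: generated_subgroup.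
Qed.

(** Finitely many elements involve only finitely many corrections in J. *)
Lemma generated_mod_central J s (bs : seq G) : is_subgroup J ->
    (forall x g, J x -> lconj g x = x) ->
    [set: G] `<=` generated (J `|` [set` s]) ->
  exists2 js, [set` js] `<=` J & [set` bs] `<=` generated [set` s ++ js].
Proof.
move=> [J1 JM JV] cJ Gs.
have comJ x g : J x -> g * x = x * g by move=> Jx; rewrite -(lconj_mul g) cJ.
have [s1 sM sV] := generated_subgroup [set` s].
have mod_s x : exists2 j, J j & generated [set` s] (x * j).
  pose P := [set x | exists2 j, J j & generated [set` s] (x * j)].
  apply: (smallest_sub (X := P) _ _ (Gs x I)); first split.
  - by exists 1; rewrite ?mulg1.
  - move=> y z [j Jj sy] [k Jk sz]; exists (j * k); first exact: JM.
    have -> : y * z * (j * k) = (y * j) * (z * k); last exact: sM.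
    by rewrite -!mulgA (mulgA z) (comJ j z) // !mulgA.
  - move=> y [j Jj sy]; exists j^-1; first exact: JV.
    by have := sV _ sy; rewrite invgM comJ //; exact: JV.
  move=> y [Jy|sy]; first by exists y^-1; [exact: JV | rewrite mulgV].
  by exists 1 => //; rewrite mulg1; exact: sub_gen_smallest.
elim: bs => [|b bs [js sjsJ bs_js]]; first by exists [::].
have [j Jj sbj] := mod_s b; exists (j :: js).
  by move=> x /=; rewrite inE => /predU1P[->//|]; exact: sjsJ.
have [_ jM jV] := generated_subgroup [set` s ++ j :: js].
move=> x /=; rewrite inE => /predU1P[->|bsx].
  rewrite -(mulgK j b); apply: jM.
    by apply: generated_mono sbj => y /= sy; rewrite mem_cat sy.
  by apply: jV; apply: sub_gen_smallest; rewrite /= mem_cat mem_head orbT.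
apply: generated_mono (bs_js x bsx) => y /=; rewrite !mem_cat inE.
by case/orP=> ->; rewrite ?orbT.
Qed.

End Generation.

Lemma stable_of_generators (K : groupType) (T : Type) (act : K -> T -> T)
    (S : set T) (ks : seq K) :
    (forall t, act 1 t = t) ->
    (forall k l t, act (k * l) t = act k (act l t)) ->
    [set: K] `<=` generated [set` ks] ->
    (forall k t, k \in ks -> S t -> S (act k t) /\ S (act k^-1 t)) ->
  forall k t, S t -> S (act k t).
Proof.
move=> act1 actA Kks ksS k.
pose P := [set k | forall t, S t -> S (act k t) /\ S (act k^-1 t)].
suff: P k by move=> Pk t /Pk[].
apply: (smallest_sub (X := P) _ _ (Kks k I)); last first.
  by move=> x /= ksx t; exact: ksS.
split=> [t St|x y Sx Sy t St|x Sx t St] /=.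
- by rewrite invg1 act1.
- rewrite invgM !actA; split; first by apply: (Sx _ (Sy _ St).1).1.
  by apply: (Sy _ (Sx _ St).2).2.
- by rewrite invgK; have [] := Sx t St.
Qed.

(** * Presented groups *)

Section PresentedGroups.
Variables (X : choiceType) (R : word X -> word X -> Prop).

Definition presented_letter (l : X * bool) : presented_group R :=
  \pi_(presented_group R) [:: l].

Definition presented_gen (x : X) := presented_letter (x, false).

Lemma pi_catE (w1 w2 : word X) :
  \pi_(presented_group R) (w1 ++ w2) =
  \pi_(presented_group R) w1 * \pi_(presented_group R) w2.
Proof. exact: (esym (presented_mulE R w1 w2)). Qed.

Lemma presented_letterV x :
  presented_letter (x, true) = (presented_gen x)^-1.
Proof. exact: (esym (presented_invE R [:: (x, false)])). Qed.

Lemma presented_ind (P : set (presented_group R)) :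
  is_subgroup P -> (forall x, P (presented_gen x)) -> forall t, P t.
Proof.
move=> [P1 PM PV] Pgen t; rewrite -[t]reprK.
elim: (repr t) => [|[x b] w IHw]; first exact: P1.
rewrite -cat1s pi_catE; apply: PM => //.
by case: b; [rewrite -/(presented_letter _) presented_letterV; apply: PV|];
  exact: Pgen.
Qed.

Lemma presented_hom_ext (Q : groupType) (f1 f2 : presented_group R -> Q) :
    {morph f1 : x y / x * y} -> {morph f2 : x y / x * y} ->
    (forall x, f1 (presented_gen x) = f2 (presented_gen x)) ->
  forall t, f1 t = f2 t.
Proof.
move=> f1M f2M eq_gen; apply: presented_ind eq_gen; split.
- by rewrite !hom1.
- by move=> x y /= eqx eqy; rewrite f1M f2M eqx eqy.
- by move=> x /= eqx; rewrite !homV // eqx.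
Qed.

Section Lift.
Variables (Q : groupType) (f : X -> Q).

(** A map on the generators that respects the relations extends to words, and
    then to the presented group. *)
Definition letter_val (l : X * bool) : Q := if l.2 then (f l.1)^-1 else f l.1.

Definition word_val (w : word X) : Q := \prod_(l <- w) letter_val l.

Lemma word_val_cat w1 w2 : word_val (w1 ++ w2) = word_val w1 * word_val w2.
Proof. exact: big_cat. Qed.

Hypothesis fR : forall w1 w2, R w1 w2 -> word_val w1 = word_val w2.

Lemma word_val_eq w1 w2 : word_eq R w1 w2 -> word_val w1 = word_val w2.
Proof.
elim=> [w|u v _ ->|v u w _ -> _ ->|u u' v v' _ eq_u _ eq_v|[x b]|u v /fR] //.
  by rewrite !word_val_cat eq_u eq_v.
rewrite /word_val !big_cons big_nil mulg1 /letter_val /=.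
by case: b; rewrite ?mulVg ?mulgV.
Qed.

Lemma presented_lift : exists F : presented_group R -> Q,
  {morph F : x y / x * y} /\ forall x, F (presented_gen x) = f x.
Proof.
have Fpi w : word_val (repr (\pi_(presented_group R) w)) = word_val w.
  exact/word_val_eq/word_eq_repr.
exists (fun t => word_val (repr t)); split=> [x y|x].
  by rewrite -[x]reprK -[y]reprK -pi_catE !Fpi word_val_cat.
by rewrite Fpi /word_val big_seq1.
Qed.

End Lift.
End PresentedGroups.

(** * The non-abelian tensor product *)

Section TensorProduct.
Variables (G H : groupType) (aGH : G -> H -> H) (aHG : H -> G -> G).

Local Notation T := (nonabelian_tensor aGH aHG).

Definition tensor (g : G) (h : H) : T :=
  presented_gen (tensor_rel aGH aHG) (g, h).

Lemma tensor_ind (P : set T) :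
  is_subgroup P -> (forall g h, P (tensor g h)) -> forall t, P t.
Proof. by move=> sP Pt; apply: presented_ind => // -[g h]; exact: Pt. Qed.

Lemma tensor_hom_ext (Q : groupType) (f1 f2 : T -> Q) :
    {morph f1 : x y / x * y} -> {morph f2 : x y / x * y} ->
    (forall g h, f1 (tensor g h) = f2 (tensor g h)) ->
  forall t, f1 t = f2 t.
Proof.
by move=> f1M f2M eqf; apply: presented_hom_ext => // -[g h]; exact: eqf.
Qed.

Lemma tensorMl g g' h :
  tensor (g * g') h = tensor (lconj g g') (aGH g h) * tensor g h.
Proof.
rewrite /tensor /presented_gen /presented_letter -pi_catE; apply/pi_word_eq.
exact/word_eq_rel/tensor_rel_mull.
Qed.

Lemma tensorMr g h h' :
  tensor g (h * h') = tensor g h * tensor (aHG h g) (lconj h h').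
Proof.
rewrite /tensor /presented_gen /presented_letter -pi_catE; apply/pi_word_eq.
exact/word_eq_rel/tensor_rel_mulr.
Qed.

Lemma tensor_lift (Q : groupType) (f : G -> H -> Q) :
    (forall g g' h, f (g * g') h = f (lconj g g') (aGH g h) * f g h) ->
    (forall g h h', f g (h * h') = f g h * f (aHG h g) (lconj h h')) ->
  exists F : T -> Q, {morph F : x y / x * y} /\
    forall g h, F (tensor g h) = f g h.
Proof.
move=> fMl fMr; pose f' (x : G * H) := f x.1 x.2.
have [|F [FM Fgen]] := @presented_lift _ (tensor_rel aGH aHG) Q f'.
  move=> _ _ [g g' h|g h h']; rewrite /word_val !big_cons big_nil !mulg1.
    exact: fMl.
  exact: fMr.
by exists F; split=> // g h; exact: Fgen.
Qed.

Hypotheses (act_GH : acts_by_automorphisms aGH)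
  (act_HG : acts_by_automorphisms aHG) (compat : compatible_actions aGH aHG).

Lemma aGH1 h : aGH 1 h = h. Proof. by case: act_GH. Qed.
Lemma aGHA g g' h : aGH (g * g') h = aGH g (aGH g' h).
Proof. by case: act_GH. Qed.
Lemma aGHM g : {morph aGH g : h h' / h * h'}. Proof. by case: act_GH. Qed.
Lemma aHG1 g : aHG 1 g = g. Proof. by case: act_HG. Qed.
Lemma aHGA h h' g : aHG (h * h') g = aHG h (aHG h' g).
Proof. by case: act_HG. Qed.
Lemma aHGM h : {morph aHG h : g g' / g * g'}. Proof. by case: act_HG. Qed.

Lemma compatH g h h' : aGH (aHG h g) h' = lconj h (aGH g (lconj h^-1 h')).
Proof. by case: compat => -> _; rewrite /lconj invgK. Qed.

Lemma compatG g h g' : aHG (aGH g h) g' = lconj g (aHG h (lconj g^-1 g')).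
Proof. by case: compat => _ ->; rewrite /lconj invgK. Qed.

(** The diagonal action of G respects the relations that expand a product in
    the first argument because aGH is an action, and those that expand a product
    in the second argument because of compatibility. The roles are exchanged for
    the action of H below. *)
Lemma ex_actG g : exists F : T -> T, {morph F : x y / x * y} /\
  forall g' h, F (tensor g' h) = tensor (lconj g g') (aGH g h).
Proof.
apply: (tensor_lift (f := fun g' h => tensor (lconj g g') (aGH g h))).
  move=> g1 g2 h; rewrite lconjM tensorMl; congr (tensor _ _ * _).
    by rewrite -!lconjA lconj_mul.
  by rewrite -!aGHA lconj_mul.
move=> g1 h h'; rewrite aGHM tensorMr; congr (_ * tensor _ _).
  by rewrite compatG lconjK.
by rewrite homJ //; exact: aGHM.
Qed.

Lemma ex_actH h : exists F : T -> T, {morph F : x y / x * y} /\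
  forall g h', F (tensor g h') = tensor (aHG h g) (lconj h h').
Proof.
apply: (tensor_lift (f := fun g h' => tensor (aHG h g) (lconj h h'))).
  move=> g g' h'; rewrite aHGM tensorMl; congr (tensor _ _ * _).
    by rewrite homJ //; exact: aHGM.
  by rewrite compatH lconjK.
move=> g h1 h2; rewrite lconjM tensorMr; congr (_ * tensor _ _).
  by rewrite -!aHGA lconj_mul.
by rewrite -!lconjA lconj_mul.
Qed.

Lemma ex_toG : exists F : T -> G, {morph F : x y / x * y} /\
  forall g h, F (tensor g h) = g * aHG h g^-1.
Proof.
apply: (tensor_lift (f := fun g h => g * aHG h g^-1)).
  move=> g g' h; rewrite -(homV (lconjM g)) compatG lconjK.
  by rewrite invgM aHGM; gsimp.
move=> g h h'; rewrite -(homV (aHGM h)) -[aHG _ (aHG h _)]aHGA lconj_mul.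
by rewrite aHGA (homV (aHGM h)); gsimp.
Qed.

Lemma ex_toH : exists F : T -> H, {morph F : x y / x * y} /\
  forall g h, F (tensor g h) = aGH g h * h^-1.
Proof.
apply: (tensor_lift (f := fun g h => aGH g h * h^-1)).
  by move=> g g' h; rewrite -aGHA lconj_mul aGHA; gsimp.
by move=> g h h'; rewrite compatH lconjK aGHM; gsimp.
Qed.

Definition actG g : T -> T := projT1 (cid (ex_actG g)).
Definition actH h : T -> T := projT1 (cid (ex_actH h)).
Definition toG : T -> G := projT1 (cid ex_toG).
Definition toH : T -> H := projT1 (cid ex_toH).

Lemma actGM g : {morph actG g : x y / x * y}.
Proof. exact: (projT2 (cid (ex_actG g))).1. Qed.

Lemma actGE g g' h : actG g (tensor g' h) = tensor (lconj g g') (aGH g h).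
Proof. exact: (projT2 (cid (ex_actG g))).2. Qed.

Lemma actHM h : {morph actH h : x y / x * y}.
Proof. exact: (projT2 (cid (ex_actH h))).1. Qed.

Lemma actHE h g h' : actH h (tensor g h') = tensor (aHG h g) (lconj h h').
Proof. exact: (projT2 (cid (ex_actH h))).2. Qed.

Lemma toGM : {morph toG : x y / x * y}.
Proof. exact: (projT2 (cid ex_toG)).1. Qed.

Lemma toGE g h : toG (tensor g h) = g * aHG h g^-1.
Proof. exact: (projT2 (cid ex_toG)).2. Qed.

Lemma toHM : {morph toH : x y / x * y}.
Proof. exact: (projT2 (cid ex_toH)).1. Qed.

Lemma toHE g h : toH (tensor g h) = aGH g h * h^-1.
Proof. exact: (projT2 (cid ex_toH)).2. Qed.

Lemma actG1 t : actG 1 t = t.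
Proof.
apply: (tensor_hom_ext (f1 := actG 1) (f2 := id)) => //; first exact: actGM.
by move=> g h; rewrite actGE lconj1 aGH1.
Qed.

Lemma actGA g g' t : actG (g * g') t = actG g (actG g' t).
Proof.
apply: (tensor_hom_ext (f1 := actG _) (f2 := actG g \o actG g')).
- exact: actGM.
- by apply: hom_comp; exact: actGM.
- by move=> g1 h /=; rewrite !actGE lconjA aGHA.
Qed.

Lemma actH1 t : actH 1 t = t.
Proof.
apply: (tensor_hom_ext (f1 := actH 1) (f2 := id)) => //; first exact: actHM.
by move=> g h; rewrite actHE lconj1 aHG1.
Qed.

Lemma actHA h h' t : actH (h * h') t = actH h (actH h' t).
Proof.
apply: (tensor_hom_ext (f1 := actH _) (f2 := actH h \o actH h')).
- exact: actHM.
- by apply: hom_comp; exact: actHM.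
- by move=> g h1 /=; rewrite !actHE lconjA aHGA.
Qed.

Lemma actGK g : cancel (actG g) (actG g^-1).
Proof. by move=> t; rewrite -actGA mulVg actG1. Qed.

Lemma actGVK g : cancel (actG g^-1) (actG g).
Proof. by move=> t; rewrite -actGA mulgV actG1. Qed.

Lemma actHK h : cancel (actH h) (actH h^-1).
Proof. by move=> t; rewrite -actHA mulVg actH1. Qed.

Lemma actHVK h : cancel (actH h^-1) (actH h).
Proof. by move=> t; rewrite -actHA mulgV actH1. Qed.

(** The compatibility conditions, lifted from G and H to the tensor product. *)
Lemma actG_aHG g h t :
  actG (aHG h g) t = actH h (actG g (actH h^-1 t)).
Proof.
apply: (tensor_hom_ext (f1 := actG _) (f2 := actH h \o (actG g \o actH h^-1))).
- exact: actGM.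
- apply: hom_comp; first exact: actHM.
  by apply: hom_comp; [exact: actGM | exact: actHM].
- move=> g' h' /=; rewrite !(actGE, actHE) compatH; congr tensor.
  by rewrite (homJ (aHGM h)) -aHGA mulgV aHG1.
Qed.

Lemma actH_aGH g h t :
  actH (aGH g h) t = actG g (actH h (actG g^-1 t)).
Proof.
apply: (tensor_hom_ext (f1 := actH _) (f2 := actG g \o (actH h \o actG g^-1))).
- exact: actHM.
- apply: hom_comp; first exact: actGM.
  by apply: hom_comp; [exact: actHM | exact: actGM].
- move=> g' h' /=; rewrite !(actGE, actHE) compatG; congr tensor.
  by rewrite (homJ (aGHM g)) -aGHA mulgV aGH1.
Qed.

Lemma tensorMl_act g g' h :
  tensor (g * g') h = actG g (tensor g' h) * tensor g h.
Proof. by rewrite tensorMl actGE. Qed.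

Lemma tensorMr_act g h h' :
  tensor g (h * h') = tensor g h * actH h (tensor g h').
Proof. by rewrite tensorMr actHE. Qed.

Lemma tensor1g h : tensor 1 h = 1.
Proof.
apply: (@mulgI _ (tensor 1 h)).
by rewrite -{1}(actG1 (tensor 1 h)) -tensorMl_act !mulg1.
Qed.

Lemma tensorg1 g : tensor g 1 = 1.
Proof.
apply: (@mulgI _ (tensor g 1)).
by rewrite -{2}(actH1 (tensor g 1)) -tensorMr_act !mulg1.
Qed.

(** Expanding (g g') (x) (h h') on the left first or on the right first gives
    two products that agree except in their middle factors. *)
Lemma tensor_exchange g h t :
  tensor g h * actH h (actG g t) = actG g (actH h t) * tensor g h.
Proof.
suff: lconj (tensor g h) (actH h (actG g t)) = actG g (actH h t).
  by move=> <-; rewrite lconj_mul.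
apply: (tensor_hom_ext (f1 := lconj _ \o (actH h \o actG g))
                       (f2 := actG g \o actH h)).
- apply: hom_comp; first exact: lconjM.
  by apply: hom_comp; [exact: actHM | exact: actGM].
- by apply: hom_comp; [exact: actGM | exact: actHM].
move=> g' h' /=.
have expandl : tensor (g * g') (h * h') =
    actG g (tensor g' h) * actG g (actH h (tensor g' h')) *
      tensor g h * actH h (tensor g h').
  by rewrite tensorMl_act !tensorMr_act actGM !mulgA.
have expandr : tensor (g * g') (h * h') =
    actG g (tensor g' h) * tensor g h *
      actH h (actG g (tensor g' h')) * actH h (tensor g h').
  by rewrite tensorMr_act !tensorMl_act actHM !mulgA.
have := etrans (esym expandr) expandl; rewrite -!mulgA => /mulgI.
by rewrite !mulgA => /mulIg eq_exchange; rewrite /lconj eq_exchange mulgK.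
Qed.

(** By tensor_exchange a generator g (x) h conjugates T as the commutator
    g h g^-1 h^-1 of the two actions; compatibility identifies h g^-1 h^-1 with
    the action of an element of G, which makes that commutator the action of
    toG (g (x) h). *)
Lemma actG_toG s t : actG (toG s) t = lconj s t.
Proof.
apply: (tensor_ind (P := [set s | forall t, actG (toG s) t = lconj s t])).
  split=> [u|x y /= Ex Ey u|x /= Ex u].
  - by rewrite /= (hom1 toGM) actG1 lconj1.
  - by rewrite toGM actGA Ey Ex lconjA.
  - by rewrite (homV toGM) -[u in LHS](lconjVK x) -Ex actGK.
move=> g h u /=; rewrite toGE actGA actG_aHG.
apply: (@mulIg _ (tensor g h)).
by rewrite lconj_mul -tensor_exchange actGVK actHVK.
Qed.

Lemma actH_toH s t : actH (toH s) t = lconj s t.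
Proof.
apply: (tensor_ind (P := [set s | forall t, actH (toH s) t = lconj s t])).
  split=> [u|x y /= Ex Ey u|x /= Ex u].
  - by rewrite /= (hom1 toHM) actH1 lconj1.
  - by rewrite toHM actHA Ey Ex lconjA.
  - by rewrite (homV toHM) -[u in LHS](lconjVK x) -Ex actHK.
move=> g h u /=; rewrite toHE actHA actH_aGH.
apply: (@mulIg _ (tensor g h)).
by rewrite lconj_mul -tensor_exchange actGVK actHVK.
Qed.

Lemma tensorVl g h : tensor g^-1 h = (actG g^-1 (tensor g h))^-1.
Proof.
by apply/esym/mulg1_eq; rewrite -tensorMl_act mulVg tensor1g.
Qed.

Lemma tensorVr g h : tensor g h^-1 = (actH h^-1 (tensor g h))^-1.
Proof.
have := tensorMr_act g h^-1 h; rewrite mulVg tensorg1 => /esym/mulg1_eq eqV.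
by rewrite -eqV invgK.
Qed.

(** Both sides are crossed homomorphisms in t, because toH t acts as conjugation
    by t; so it is enough to compare them on generators. There the identity
    reduces to the two expansions of (g g') (x) h coming from
    g g' = g' (g'^-1 g g'). *)
Lemma tensor_toH g t : tensor g (toH t) = actG g t * t^-1.
Proof.
apply: (tensor_ind (P := [set t | tensor g (toH t) = actG g t * t^-1])).
  split=> [|x y /= Ex Ey|x /= Ex].
  - by rewrite /= (hom1 toHM) (hom1 (actGM g)) tensorg1 mulgV.
  - by rewrite toHM tensorMr_act actH_toH Ex Ey actGM; gsimp.
  - have := tensorMr_act g (toH x) (toH x)^-1.
    rewrite mulgV tensorg1 actH_toH Ex -(homV toHM) (homV (actGM g)).
    move=> /esym/mulg1_eq eqV; apply: (can_inj (lconjK x)).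
    by rewrite /= -eqV; gsimp.
move=> g' h; rewrite /= toHE tensorMr_act tensorVr (homV (actHM _)) -actHA.
rewrite -toHE actH_toH.
have -> : tensor g (aGH g' h) =
    actG g (tensor g' h) * tensor g h * (tensor g' h)^-1.
  apply: (canRL (mulgK _)); rewrite -tensorMl_act.
  have -> : g * g' = g' * lconj g'^-1 g by gsimp.
  by rewrite tensorMl_act actGE lconjVK.
by gsimp.
Qed.

(** The mirror image of the preceding identity, by the same argument. *)
Lemma tensor_toG t h : tensor (toG t) h = t * (actH h t)^-1.
Proof.
apply: (tensor_ind (P := [set t | tensor (toG t) h = t * (actH h t)^-1])).
  split=> [|x y /= Ex Ey|x /= Ex].
  - by rewrite /= (hom1 toGM) (hom1 (actHM h)) tensor1g mulgV.
  - by rewrite toGM tensorMl_act actG_toG Ex Ey actHM; gsimp.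
  - have := tensorMl_act (toG x) (toG x)^-1 h.
    rewrite mulgV tensor1g actG_toG Ex -(homV toGM) (homV (actHM h)).
    move=> /esym/mulg1_eq eqV; apply: (can_inj (lconjK x)).
    by apply: invg_inj; rewrite eqV; gsimp.
move=> g h'; rewrite /= toGE tensorMl_act (homV (aHGM h')) tensorVl.
rewrite (homV (actGM _)) -actGA -(homV (aHGM h')) -toGE actG_toG.
(* Both sides are g (x) (h h'), since h h' = h' (h'^-1 h h'). *)
have key : tensor g h' * tensor (aHG h' g) h =
    tensor g h * actH h (tensor g h').
  rewrite -tensorMr_act -[h * h'](mulVKg h') tensorMr_act actHE.
  by congr (_ * tensor _ _); gsimp.
have -> : tensor (aHG h' g) h =
    (tensor g h')^-1 * (tensor g h * actH h (tensor g h')).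
  by rewrite -key mulKg.
by gsimp.
Qed.

Lemma actG_fix g t : toH t = 1 -> actG g t = t.
Proof.
by move=> t1; apply: divg1_eq; rewrite -tensor_toH t1 tensorg1.
Qed.

Lemma actH_fix h t : toG t = 1 -> actH h t = t.
Proof.
by move=> t1; apply/esym/divg1_eq; rewrite -tensor_toG t1 tensor1g.
Qed.

(** The intersection is written in the form in which it arises when the series
    of G and of H are pulled back one after the other. *)
Definition common_kernel : set T :=
  ([set: T] `&` toG @^-1` [set 1]) `&` toH @^-1` [set 1].

Lemma common_kernelJ t s : common_kernel t -> lconj s t = t.
Proof. by move=> [_ t1]; rewrite -actG_toG actG_fix. Qed.

Lemma common_kernel_subgroup : is_subgroup common_kernel.
Proof.
have s1 (K : groupType) : is_subgroup [set 1 : K].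
  exact/normal_is_subgroup/normal_subgroup1.
apply: subgroupI (preim_subgroup toHM (s1 _)).
apply: subgroupI (preim_subgroup toGM (s1 _)).
exact/normal_is_subgroup/normal_subgroupT.
Qed.

(** The subgroup S generated by s and suitable elements of the common kernel is
    stable under the generators of G and H: the elements of s are sent into S
    by the choice of these elements, which are fixed themselves. *)
Lemma tensor_finitely_generated (s : seq T) :
    finitely_generated G -> finitely_generated H ->
    [set: T] `<=` generated (common_kernel `|` [set` s]) ->
  finitely_generated T.
Proof.
move=> [xs Gxs] [ys Hys] Ts.
pose bs := [seq actG x t | x <- xs, t <- s] ++
  [seq actG x^-1 t | x <- xs, t <- s] ++ [seq actH y t | y <- ys, t <- s] ++
  [seq actH y^-1 t | y <- ys, t <- s] ++ [seq tensor x y | x <- xs, y <- ys].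
have [js jsJ bsS] := generated_mod_central bs common_kernel_subgroup
  (fun t g => @common_kernelJ t g) Ts.
exists (s ++ js); set S := generated _ in bsS *.
have [S1 SM SV] : is_subgroup S := generated_subgroup _.
have stable (f : T -> T) : {morph f : x y / x * y} ->
    (forall t, common_kernel t -> f t = t) -> (forall t, t \in s -> S (f t)) ->
  forall t, S t -> S (f t).
  move=> fM fJ fs; apply: smallest_sub; first exact: preim_subgroup.
  move=> t /=; rewrite mem_cat => /orP[/fs//|jst]; rewrite /preimage /= fJ.
    by apply: sub_gen_smallest; rewrite /= mem_cat jst orbT.
  exact: jsJ.
have SG g t : S t -> S (actG g t).
  apply: (stable_of_generators actG1 actGA Gxs) => x {}t xsx St.
  split; apply: stable St => //; try exact: actGM;
    try by move=> u [_ ?]; rewrite actG_fix.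
    by move=> u su; apply: bsS; rewrite /= !mem_cat (allpairs_f _ xsx su).
  move=> u su; apply: bsS.
  by rewrite /= !mem_cat (allpairs_f (fun x t => actG x^-1 t) xsx su) !orbT.
have SH h t : S t -> S (actH h t).
  apply: (stable_of_generators actH1 actHA Hys) => y {}t ysy St.
  split; apply: stable St => //; try exact: actHM;
    try by move=> u [[_ ?] _]; rewrite actH_fix.
    move=> u su; apply: bsS.
    by rewrite /= !mem_cat (allpairs_f (fun y t => actH y t) ysy su) !orbT.
  move=> u su; apply: bsS.
  by rewrite /= !mem_cat (allpairs_f (fun y t => actH y^-1 t) ysy su) !orbT.
move=> t _; apply: tensor_ind t => // g h.
apply: (smallest_sub (X := [set h | S (tensor g h)]) _ _ (Hys h I)).
  split=> [|h1 h2 Sh1 Sh2|h1 Sh1] /=; first by rewrite tensorg1.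
    by rewrite tensorMr_act; apply: SM; last exact: SH.
  by rewrite tensorVr; apply: SV; exact: SH.
move=> y /= ysy.
apply: (smallest_sub (X := [set g | S (tensor g y)]) _ _ (Gxs g I)).
  split=> [|g1 g2 Sg1 Sg2|g1 Sg1] /=; first by rewrite tensor1g.
    by rewrite tensorMl_act; apply: SM; first exact: SG.
  by rewrite tensorVl; apply: SV; exact: SG.
move=> x /= xsx; apply: bsS; rewrite /= !mem_cat (allpairs_f _ xsx ysy).
by rewrite !orbT.
Qed.

End TensorProduct.

Theorem theorem3p5 (G H : groupType) (aGH : G -> H -> H) (aHG : H -> G -> G)
    (act_GH : acts_by_automorphisms aGH) (act_HG : acts_by_automorphisms aHG)
    (compat : compatible_actions aGH aHG)
    (ssG : supersolvable G) (ssH : supersolvable H) :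
  supersolvable (nonabelian_tensor aGH aHG).
Proof.
have fgG := supersolvable_finitely_generated ssG.
have fgH := supersolvable_finitely_generated ssH.
have [/supersolvableP serG /supersolvableP serH] := (ssG, ssH).
have toGM := toGM act_HG compat; have toHM := toHM act_GH compat.
have nT := normal_subgroupT (nonabelian_tensor aGH aHG).
have := cyclic_series_preim toGM nT serG; rewrite preimage_setT setIT => serTG.
have [nK _] := cyclic_series_normal serTG.
have := cyclic_series_preim toHM nK serH; rewrite preimage_setT setIT => serKH.
have serT := cyclic_series_trans serKH serTG.
have [s Ts] := cyclic_series_generated serT.
apply: central_supersolvable serT _.
  exact: tensor_finitely_generated fgG fgH Ts.
by move=> t u; exact: common_kernelJ.
Qed.
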